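(* Let $(\Omega,\mathcal L,\mu)$ be a measure space, $X$ a Banach space, and let $\widetilde{\Gamma}\colon\Omega\to\mathcal F(X)$ be a scalarly integrable fuzzy mapping. Then the following conditions are equivalent: (i) $\widetilde{\Gamma}$ is Pettis integrable on $\Omega$ (as a fuzzy mapping); (ii) $\mathcal S(\widetilde{\Gamma}_1)\neq\emptyset$ and, for every $f\in\mathcal S(\widetilde{\Gamma}_1)$, there exists a Pettis integrable fuzzy mapping $\widetilde{G}\colon\Omega\to\mathcal F(X)$ such that $\widetilde{\Gamma}(\omega)=\widetilde{G}(\omega)+\widetilde{f}(\omega)$ for each $\omega\in\Omega$ (where $\widetilde f$ is the fuzzy mapping associated to $f$) and, for each $r\in(0,1]$ and each $\omega\in\Omega$, $0\in\widetilde{G}_r(\omega)$.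
   Context: $(\Omega,\mathcal L,\mu)$ is a measure space, $\mathcal L$ being the family of all $\mu$-measurable sets; $X$ is a (real) Banach space with dual $X^*$. $cwk(X)$ is the family of nonempty convex weakly compact subsets of $X$, with Minkowski addition. For $A\in cwk(X)$ and $x^*\in X^*$, $s(x^*,A)=\sup\{\langle x^*,y\rangle: y\in A\}$ (support function). Fuzzy numbers: for $u\colon X\to[0,1]$ and $r\in(0,1]$ put $[u]^r=\{x\in X: u(x)\ge r\}$. $u$ is a generalized fuzzy number if $[u]^r\in cwk(X)$ for every $r\in(0,1]$; $\mathcal F(X)$ is the set of all generalized fuzzy numbers. Addition in $\mathcal F(X)$ is given by $[u+v]^r=[u]^r+[v]^r$ for each $r\in(0,1]$ (equivalently $(u+v)(x)=\sup_{x=y+z}\min(u(y),v(z))$). A fuzzy mapping is a map $\widetilde{\Gamma}\colon\Omega\to\mathcal F(X)$; set $\widetilde{\Gamma}_r(\omega):=[\widetilde{\Gamma}(\omega)]^r$. Multifunctions: $\Gamma\colon\Omega\to cwk(X)$ is scalarly integrable if the function $\omega\mapsto s(x^*,\Gamma(\omega))$ is $\mu$-integrable for each $x^*\in X^*$. It is Pettis integrable if it is scalarly integrable and for each $A\in\mathcal L$ there is $W_\Gamma(A)\in cwk(X)$ with $s(x^*,W_\Gamma(A))=\int_A s(x^*,\Gamma)\,d\mu$ for all $x^*\in X^*$. A function $f\colon\Omega\to X$ is Pettis integrable if $x^*f$ is integrable for each $x^*\in X^*$ and for each $A\in\mathcal L$ there is $F(A)\in X$ with $x^*(F(A))=\int_A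 x^*f\,d\mu$ for all $x^*\in X^*$. $\mathcal S(\Gamma)$ is the family of all Pettis integrable functions $f\colon\Omega\to X$ with $f(\omega)\in\Gamma(\omega)$ for every $\omega\in\Omega$. For $f\colon\Omega\to X$, the fuzzy mapping associated to $f$ is $\widetilde f(\omega):=\chi_{\{f(\omega)\}}$. Fuzzy mappings: $\widetilde{\Gamma}$ is scalarly integrable if $\widetilde{\Gamma}_r$ is scalarly integrable for all $r\in(0,1]$. $\widetilde{\Gamma}$ is Pettis integrable on $\Omega$ if every $\widetilde{\Gamma}_r$, $r\in(0,1]$, is a Pettis integrable multifunction and, for each $A\in\mathcal L$, there is a generalized fuzzy number $\widetilde{M_\Gamma}(A)\in\mathcal F(X)$ such that $s(x^*,[\widetilde{M_\Gamma}(A)]^r)=\int_A s(x^*,\widetilde{\Gamma}_r)\,d\mu$ for all $r\in(0,1]$ and $x^*\in X^*$. *)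

(* Defs.v *)
From HB Require Import structures.
From mathcomp Require Import all_boot all_order all_algebra.
From mathcomp Require Import all_classical all_reals all_analysis.
Import Order.TTheory GRing.Theory Num.Theory.
Import numFieldNormedType.Exports.

Set Implicit Arguments.
Unset Strict Implicit.
Unset Printing Implicit Defensive.

Local Open Scope classical_set_scope.
Local Open Scope ring_scope.

Section weak_compactness.
Context {R : realType} (X : normedModType R).

(* The topological dual X^*. *)
Record dual := Dual {
  dual_fun :> {linear X -> R^o} ;
  dual_continuous : continuous dual_fun }.

(* X with the weak topology: the coarsest one making all of X^* continuous. *)
Definition weakly : topologicalType :=
  sup_topology (fun x' : dual =>
    Topological.class (initial_topology (x' : X -> R^o))).

Definition weakly_compact (A : set X) : Prop := compact (A : set weakly).

Definition cwk (A : set X) : Prop :=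
  [/\ A !=set0, convex_set (A : set (convex_lmodType X)) & weakly_compact A].

End weak_compactness.

Section fuzzy_numbers.
Context {R : realType} {X : normedModType R}.

(* [u]^r *)
Definition level (u : X -> R) (r : R) : set X := [set x | r <= u x].

Record fuzzy_number := FuzzyNumber {
  membership :> X -> R ;
  membership_itv : forall x, 0 <= membership x <= 1 ;
  level_cwk : forall r, 0 < r <= 1 -> cwk (level membership r) }.

(* w = u + v in F(X), addition being determined by
   [u + v]^r = [u]^r + [v]^r for r in (0, 1]. *)
Definition is_fuzzy_sum (w u v : fuzzy_number) : Prop :=
  forall r : R, 0 < r <= 1 ->
    level w r = [set y + z | y in level u r & z in level v r].

Lemma membership_inj (u v : fuzzy_number) :
  (forall r : R, 0 < r <= 1 -> level u r = level v r) ->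
  membership u = membership v.
Proof.
have le (u' v' : fuzzy_number) x :
    (forall r : R, 0 < r <= 1 -> level u' r = level v' r) -> u' x <= v' x.
  move=> uv; have /andP[u0 u1] := membership_itv u' x.
  move: u0; rewrite le_eqVlt => /predU1P[<-|u0].
    by have /andP[] := membership_itv v' x.
  have h : level u' (u' x) x by exact: lexx.
  by rewrite uv ?u0// in h.
move=> uv; apply/funext => x; apply/eqP; rewrite eq_le.
by rewrite le// le// => r r01; rewrite uv.
Qed.

Lemma is_fuzzy_sum_unique (w w' u v : fuzzy_number) :
  is_fuzzy_sum w u v -> is_fuzzy_sum w' u v ->
  membership w = membership w'.
Proof. by move=> h h'; apply: membership_inj => r r01; rewrite h// h'. Qed.

Lemma level_indic1 (a : X) (r : R) : 0 < r <= 1 ->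
  level \1_[set a] r = [set a].
Proof.
move=> /andP[r0 r1]; apply/seteqP; split=> [x|_ ->]; rewrite /level/= indicE.
  case: (boolP (x \in [set a])) => [|_]; first by rewrite inE.
  by rewrite leNgt r0.
by rewrite mem_set.
Qed.

Lemma indic1_itv (a x : X) : 0 <= (\1_[set a] x : R) <= 1.
Proof. by rewrite indicE; case: (_ \in _); rewrite /= ?lexx ler01. Qed.

Lemma level_indic1_cwk (a : X) (r : R) : 0 < r <= 1 ->
  cwk (level (\1_[set a] : X -> R) r).
Proof.
move=> r01; rewrite level_indic1//; split; first by exists a.
- by move=> x y p; rewrite !inE => -> ->; rewrite convmm.
- exact: compact_set1.
Qed.

(* The generalized fuzzy number chi_{a}. *)
Definition fuzzy_point (a : X) : fuzzy_number :=
  FuzzyNumber (indic1_itv a) (@level_indic1_cwk a).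

End fuzzy_numbers.

Arguments fuzzy_number {R} X.

Section integrals.
Context {R : realType} {X : normedModType R}.
Context {d : measure_display} {T : measurableType d}.
Variable mu : {measure set T -> \bar R}.

(* s(x^*, A); the supremum is finite for A in cwk(X). *)
Definition support_fun (x' : dual X) (A : set X) : R := sup (x' @` A).

(* A multifunction is a map G : T -> set X, here only used with values
   in cwk(X) (the levels of a fuzzy mapping). *)

Definition scalarly_integrable (G : T -> set X) : Prop :=
  forall x' : dual X,
    mu.-integrable setT (fun t => (support_fun x' (G t))%:E).

Definition pettis_integrable (G : T -> set X) : Prop :=
  scalarly_integrable G /\
  forall A : set T, measurable A -> exists W : set X, cwk W /\
    forall x' : dual X,
      (support_fun x' W)%:E = (\int[mu]_(t in A) (support_fun x' (G t))%:E)%E.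

Definition pettis_integrable_fun (f : T -> X) : Prop :=
  (forall x' : dual X, mu.-integrable setT (fun t => (x' (f t) : R)%:E)) /\
  forall A : set T, measurable A -> exists F : X,
    forall x' : dual X,
      (x' F : R)%:E = (\int[mu]_(t in A) (x' (f t) : R)%:E)%E.

(* S(G) *)
Definition pettis_selections (G : T -> set X) : set (T -> X) :=
  [set f | pettis_integrable_fun f /\ forall t, G t (f t)].

Definition fuzzy_level (G : T -> fuzzy_number X) (r : R) : T -> set X :=
  fun t => level (G t) r.

Definition fuzzy_scalarly_integrable (G : T -> fuzzy_number X) : Prop :=
  forall r : R, 0 < r <= 1 -> scalarly_integrable (fuzzy_level G r).

Definition fuzzy_pettis_integrable (G : T -> fuzzy_number X) : Prop :=
  (forall r : R, 0 < r <= 1 -> pettis_integrable (fuzzy_level G r)) /\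
  forall A : set T, measurable A -> exists M : fuzzy_number X,
    forall (r : R) (x' : dual X), 0 < r <= 1 ->
      (support_fun x' (level M r))%:E
      = (\int[mu]_(t in A) (support_fun x' (fuzzy_level G r t))%:E)%E.

End integrals.

(* Main.v *)
(* Translating a Pettis integrable fuzzy mapping by a Pettis integrable function
   preserves Pettis integrability, so everything reduces to finding a Pettis
   integrable selection of a multifunction F that has a Pettis integral W. If f
   is a functional, the faces of F(t) and of W(A) in direction f are again linked
   by integration: their support functions are directional derivatives of those
   of F(t) and W(A), and dominated convergence applies. The same holds for
   decreasing countable intersections. Now a weakly compact set has iterated
   faces of arbitrarily small diameter, hence a sequence of nested iterated faces
   that shrinks W(Omega) to a point. Applying the same functionals to F(t), one
   gets a multifunction whose integral over Omega is a point; its width in every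
   direction vanishes almost everywhere, so each of its selections is scalarly
   measurable (mu is complete) and Pettis integrable. *)

From HB Require Import structures.
Require Import Defs.
From mathcomp Require Import all_boot all_order all_algebra.
From mathcomp Require Import all_classical all_reals all_analysis.
From mathcomp Require Import measurable_realfun ring lra.
Import Order.TTheory GRing.Theory Num.Theory.
Import numFieldNormedType.Exports.
Set Implicit Arguments.
Unset Strict Implicit.
Unset Printing Implicit Defensive.
Local Open Scope classical_set_scope.
Local Open Scope ring_scope.

(** * Hahn-Banach *)

Section hahn_banach.
Context {R : realType} {V : lmodType R}.
Implicit Types p q : V -> R.

Definition sublinear p : Prop :=
  (forall x y, p (x + y) <= p x + p y) /\
  (forall (t : R) x, 0 <= t -> p (t *: x) <= t * p x).

Lemma sublinear0 p : sublinear p -> p 0 = 0.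
Proof.
move=> [pD pZ]; have h1 := pD 0 0; have h2 := pZ 0 0 (lexx 0).
rewrite addr0 in h1; rewrite scale0r in h2; lra.
Qed.

Lemma sublinearZ p (t : R) x : sublinear p -> 0 <= t -> p (t *: x) = t * p x.
Proof.
move=> sp; rewrite le_eqVlt => /predU1P[<-|t0].
  by rewrite scale0r mul0r sublinear0.
case: sp => pD pZ; apply/eqP; rewrite eq_le pZ ?(ltW t0)//=.
have := pZ t^-1 (t *: x); rewrite invr_ge0 (ltW t0) scalerA mulVf ?gt_eqF// scale1r.
by move=> /(_ isT); rewrite ler_pdivlMl.
Qed.

Lemma sublinear_geN p x : sublinear p -> - p (- x) <= p x.
Proof.
move=> sp; have := sublinear0 sp; have := sp.1 x (- x); rewrite subrr; lra.
Qed.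

Lemma le_infD (A B : set R) c : A !=set0 -> B !=set0 ->
  (forall a b, A a -> B b -> c <= a + b) -> c <= inf A + inf B.
Proof.
move=> A0 B0 h; rewrite -lerBlDr; apply: lb_le_inf => // a Aa.
rewrite lerBlDr -lerBlDl; apply: lb_le_inf => // b Bb.
by rewrite lerBlDl h.
Qed.

Lemma le_pmul_inf (A : set R) c t : A !=set0 -> 0 < t ->
  (forall a, A a -> c <= t * a) -> c <= t * inf A.
Proof.
move=> A0 t0 h; rewrite -ler_pdivrMl//; apply: lb_le_inf => // a Aa.
by rewrite ler_pdivrMl// h.
Qed.

(** The auxiliary functional of the Hahn-Banach argument, for sublinear [p]: [t = 0] puts it below
    [p], and [t = 1] gives at most [- p y] at [- y], so a linear functional below it is at least
    [p y] at [y]. *)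
Definition tilt p y x : R := inf [set p (x + t *: y) - t * p y | t in [set t | 0 <= t]].

Lemma tilt_le p y x t : sublinear p -> 0 <= t ->
  tilt p y x <= p (x + t *: y) - t * p y.
Proof.
move=> sp t0; apply: ge_inf; last by exists t.
(* The infimum is finite because [p (s *: y) <= p (x + s *: y) + p (- x)]. *)
exists (- p (- x)) => _ [s s0 <-].
have := sp.1 (x + s *: y) (- x).
by rewrite addrAC subrr add0r sublinearZ//; lra.
Qed.

Lemma tilt_nonempty p y x :
  [set p (x + t *: y) - t * p y | t in [set t | 0 <= t]] !=set0.
Proof. by exists (p (x + 0 *: y) - 0 * p y), 0 => /=. Qed.

Lemma tilt_sublinear p y : sublinear p -> sublinear (tilt p y).
Proof.
move=> sp; split=> [x1 x2|t x].
  apply: le_infD; [exact: tilt_nonempty..|].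
  move=> _ _ [t1 /= t10 <-] [t2 /= t20 <-].
  apply: le_trans (tilt_le _ _ sp (addr_ge0 t10 t20)) _.
  have := sp.1 (x1 + t1 *: y) (x2 + t2 *: y).
  by rewrite scalerDl addrACA; lra.
rewrite le_eqVlt => /predU1P[<-|t0].
  rewrite scale0r mul0r; apply: le_trans (tilt_le _ _ sp (lexx 0)) _.
  by rewrite scale0r addr0 mul0r sublinear0// subrr.
apply: le_pmul_inf => //; first exact: tilt_nonempty.
move=> _ [s /= s0 <-].
apply: le_trans (tilt_le _ _ sp (mulr_ge0 (ltW t0) s0)) _.
by rewrite -scalerA -scalerDr sublinearZ ?(ltW t0)//; lra.
Qed.

(** Zorn's lemma for the reversed pointwise order. A nonempty chain is bounded by its pointwise
    infimum, finite thanks to the bound [- p (- x)], and subadditive because the smaller of two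
    members serves both arguments. *)
Lemma exists_minimal_sublinear p : sublinear p ->
  exists q, [/\ sublinear q, (forall x, q x <= p x) &
    forall r, sublinear r -> (forall x, r x <= q x) -> forall x, r x = q x].
Proof.
move=> sp; pose P q := sublinear q /\ forall x, q x <= p x.
pose S := {q | P q}.
pose ge (s t : S) := `[< forall x, sval t x <= sval s x >].
have [] := @Zorn S ge.
- by move=> t; apply/asboolP.
- move=> r s t /asboolP rs /asboolP st; apply/asboolP => x.
  exact: le_trans (st x) (rs x).
- move=> [s Ps] [t Pt] /asboolP/= st /asboolP/= ts; apply: eq_exist.
  by apply/funext => x; apply/eqP; rewrite eq_le st ts.
- move=> A totA; have [[a0 Aa0]|A0] := pselect (A !=set0); last first.
    by exists (exist _ p (conj sp (fun=> lexx _))) => s As; case: A0; exists s.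
  pose val x := [set sval q x | q in A].
  have val0 x : val x !=set0 by exists (sval a0 x), a0.
  have lb x s : A s -> inf (val x) <= sval s x.
    move=> As; apply: ge_inf; last by exists s.
    exists (- p (- x)) => _ [[q [sq qp]] _ <-] /=.
    by apply: le_trans (sublinear_geN x sq); rewrite lerN2.
  have sinf : P (fun x => inf (val x)).
    split; last by move=> x; apply: le_trans (lb x _ Aa0) ((svalP a0).2 x).
    split=> [x y|t x].
      apply: le_infD => // _ _ [q1 Aq1 <-] [q2 Aq2 <-].
      case: (totA _ _ Aq1 Aq2) => /asboolP h.
        apply: le_trans (lb _ _ Aq2) _; apply: le_trans ((svalP q2).1.1 x y) _.
        by rewrite lerD2r.
      apply: le_trans (lb _ _ Aq1) _; apply: le_trans ((svalP q1).1.1 x y) _.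
      by rewrite lerD2l.
    rewrite le_eqVlt => /predU1P[<-|t0].
      rewrite mul0r; apply: le_trans (lb _ _ Aa0) _.
      by rewrite scale0r sublinear0//; case: (svalP a0).
    apply: le_pmul_inf => // _ [q Aq <-].
    by apply: le_trans (lb _ _ Aq) _; apply: (svalP q).1.2; exact: ltW.
  by exists (exist _ _ sinf) => s As; apply/asboolP => x; exact: lb.
- move=> [q [sq qp]] qmin; exists q; split=> // r sr rq x.
  have Pr : P r by split=> // z; exact: le_trans (rq z) (qp z).
  have /qmin/(congr1 sval)/= -> // : ge (exist _ q (conj sq qp)) (exist _ r Pr).
  exact/asboolP.
Qed.

(* A minimal sublinear functional coincides with all its tilts, hence is
   additive. *)
Lemma hahn_banach p v : sublinear p ->
  exists l : {linear V -> R^o}, (forall x, l x <= p x) /\ l v = p v.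
Proof.
move=> sp; have [q [sq qt qmin]] := exists_minimal_sublinear (tilt_sublinear v sp).
have qD x y : q (x + y) = q x + q y.
  apply/eqP; rewrite eq_le sq.1/=.
  have <- : tilt q y x = q x.
    apply: qmin; first exact: tilt_sublinear.
    move=> z; apply: le_trans (tilt_le y z sq (lexx 0)) _.
    by rewrite scale0r addr0 mul0r subr0.
  have := tilt_le y x sq ler01; rewrite scale1r; lra.
have qN x : q (- x) = - q x.
  by have := qD x (- x); rewrite subrr sublinear0//; lra.
have qZ t x : q (t *: x) = t * q x.
  have [t0|t0] := leP 0 t; first exact: sublinearZ.
  have := @sublinearZ q (- t) x sq; rewrite oppr_ge0 ltW// => /(_ isT).
  by rewrite scaleNr qN; lra.
have ql : linear (q : V -> R^o) by move=> t x y; rewrite qD qZ.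
pose lM := GRing.isLinear.Build R V R^o _ q ql.
pose l : {linear V -> R^o} := HB.pack q lM.
have qp x : q x <= p x.
  apply: le_trans (qt x) _; apply: le_trans (tilt_le v x sp (lexx 0)) _.
  by rewrite scale0r addr0 mul0r subr0.
exists l; split => //; apply/eqP; rewrite eq_le qp/=.
have := qt (- v); have := tilt_le v (- v) sp ler01.
by rewrite scale1r addNr sublinear0// qN /=; lra.
Qed.

End hahn_banach.

(** * Weak topology *)

Lemma nested_compact (T : topologicalType) (F : nat -> set T) :
  (forall n, F n !=set0) -> (forall n, closed (F n)) -> compact (F 0%N) ->
  (forall n, F n.+1 `<=` F n) -> \bigcap_n F n !=set0.
Proof.
move=> F0 Fcl Fco Fdec.
have Fanti m n : (m <= n)%N -> F n `<=` F m.
  elim: n => [|n IH]; first by rewrite leqn0 => /eqP ->.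
  by rewrite leq_eqVlt => /predU1P[->//|/IH]; exact: subset_trans.
have PF : ProperFilter (filter_from setT F).
  apply: filter_from_proper => //; apply: filter_from_filter; first by exists 0%N.
  move=> i j _ _; exists (maxn i j) => // x Fx; split.
    exact: Fanti (leq_maxl i j) x Fx.
  exact: Fanti (leq_maxr i j) x Fx.
have [p [_ clp]] := Fco _ PF (ex_intro2 _ _ 0%N I (@subset_refl _ _)).
exists p => n _; apply: Fcl => B Bp; apply: clp => //.
by exists n.
Qed.

Section functionals.
Context {R : realType} {X : normedModType R}.

Lemma dominated_dual (l : {linear X -> R^o}) :
  (forall x, l x <= `|x|) -> exists x' : dual X, x' =1 l.
Proof.
move=> l1; suff cl : continuous l by exists (Dual cl).
apply: bounded_linear_continuous; apply/linear_boundedP.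
near=> r => x; apply: (@le_trans _ _ `|x|).
  have := l1 (- x); rewrite linearN normrN => h.
  by rewrite ler_norml l1 lerNl h.
rewrite ler_peMl//; near: r; apply: nbhs_pinfty_ge; exact: num_real.
Unshelve. all: by end_near. Qed.

Lemma sublinear_norm : sublinear (fun x : X => `|x|).
Proof.
by split=> [x y|t x t0]; rewrite ?ler_normD// normrZ ger0_norm.
Qed.

Lemma norming_dual (v : X) :
  exists x' : dual X, (forall x, x' x <= `|x|) /\ x' v = `|v|.
Proof.
have [l [l1 lv]] := hahn_banach v sublinear_norm.
by have [x' x'l] := dominated_dual l1; exists x'; split=> [x|]; rewrite x'l.
Qed.

Definition seq_span (c : nat -> X) : set X :=
  [set x | exists n (a : nat -> R), x = \sum_(i < n) a i *: c i].

Lemma seq_spanD c x y : seq_span c x -> seq_span c y -> seq_span c (x + y).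
Proof.
have widen n m (a : nat -> R) : (n <= m)%N ->
    \sum_(i < n) a i *: c i = \sum_(i < m) (if (i < n)%N then a i else 0) *: c i.
  move=> nm; rewrite (big_ord_widen m (fun i => a i *: c i) nm) big_mkcond.
  by apply: eq_bigr => i _; case: ifP; rewrite ?scale0r.
move=> [n [a ->]] [m [b ->]]; rewrite (widen _ _ a (leq_addr m n)).
rewrite (widen _ _ b (leq_addl n m)) -big_split/=.
exists (n + m)%N, (fun i => (if (i < n)%N then a i else 0) +
  (if (i < m)%N then b i else 0)).
by apply: eq_bigr => i _; rewrite scalerDl.
Qed.

Lemma seq_spanZ c t x : seq_span c x -> seq_span c (t *: x).
Proof.
move=> [n [a ->]]; exists n, (fun i => t * a i); rewrite scaler_sumr.
by apply: eq_bigr => i _; rewrite scalerA.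
Qed.

Lemma seq_span0 c : seq_span c 0.
Proof. by exists 0%N, (fun=> 0); rewrite big_ord0. Qed.

Lemma seq_span_mem c n : seq_span c (c n).
Proof.
exists n.+1, (fun i => (i == n)%:R).
rewrite big_ord_recr/= eqxx scale1r big1 ?add0r// => i _.
by rewrite ltn_eqF ?scale0r//; exact: ltn_ord.
Qed.

(* Hahn-Banach applied to the distance to the span. *)
Lemma closure_seq_span c y e : 0 < e ->
  (forall x' : dual X, (forall n, x' (c n) = 0) -> x' y = 0) ->
  exists2 s, seq_span c s & `|y - s| < e.
Proof.
move=> e0 cy; pose D x := [set `|x - s| | s in seq_span c].
have D0 x : D x !=set0 by exists `|x - 0|, 0 => //; exact: seq_span0.
have lb x s : seq_span c s -> inf (D x) <= `|x - s|.
  by move=> cs; apply: ge_inf; [exists 0 => _ [? _ <-]|exists s].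
pose p x := inf (D x).
have sp : sublinear p.
  split=> [x1 x2|t x].
    apply: le_infD => // _ _ [s1 c1 <-] [s2 c2 <-].
    apply: le_trans (lb _ _ (seq_spanD c1 c2)) _.
    by rewrite opprD addrACA ler_normD.
  rewrite le_eqVlt => /predU1P[<-|t0].
    rewrite mul0r; apply: le_trans (lb _ _ (seq_span0 c)) _.
    by rewrite scale0r subr0 normr0.
  apply: le_pmul_inf => // _ [s cs <-].
  apply: le_trans (lb _ _ (seq_spanZ t cs)) _.
  by rewrite -scalerBr normrZ gtr0_norm.
have [l [lp ly]] := hahn_banach y sp.
have l1 x : l x <= `|x|.
  by apply: le_trans (lp x) _; rewrite -[in leRHS](subr0 x); exact/lb/seq_span0.
have [x' x'l] := dominated_dual l1.
have c0 s : seq_span c s -> l s <= 0.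
  by move=> cs; apply: le_trans (lp s) _; rewrite -(normr0 X) -(subrr s); exact: lb.
have py0 : p y = 0.
  rewrite -ly -x'l; apply: cy => n; rewrite x'l; apply/eqP; rewrite eq_le.
  rewrite c0/=; last exact: seq_span_mem.
  rewrite -oppr_le0 -linearN c0// -scaleN1r; apply: seq_spanZ.
  exact: seq_span_mem.
have ye : inf (D y) < e by rewrite -/(p y) py0.
by have [_ [s cs <-] se] := inf_lt (D0 y) ye; exists s.
Qed.

(** One two-term combination covers both uses of algebra on the dual: opposites, and the perturbed
    functionals [g + n f] behind [penalty]. *)
Definition comb (a : R) (x' : dual X) (b : R) (y' : dual X) (v : X) : R^o :=
  a *: (x' v : R^o) + b *: (y' v : R^o).

Fact comb_linear a x' b y' : linear (comb a x' b y').
Proof. by move=> t u v; rewrite /comb !linearP /= /GRing.scale/=; ring. Qed.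

HB.instance Definition _ a x' b y' :=
  GRing.isLinear.Build R X R^o _ (comb a x' b y') (comb_linear a x' b y').

Fact comb_continuous a x' b y' : continuous (comb a x' b y').
Proof.
by move=> v; apply: cvgD; apply: cvgZl_tmp; exact: dual_continuous.
Qed.

Definition dual_comb a x' b y' : dual X := Dual (@comb_continuous a x' b y').

Lemma dual_combE a (x' : dual X) b (y' : dual X) v :
  dual_comb a x' b y' v = a * x' v + b * y' v :> R.
Proof. by []. Qed.

Definition dual_opp (x' : dual X) : dual X := dual_comb (-1) x' 0 x'.

Lemma dual_oppE (x' : dual X) v : dual_opp x' v = - (x' v : R) :> R.
Proof. by rewrite dual_combE mul0r addr0 mulN1r. Qed.

Lemma dual_weakly_continuous (x' : dual X) :
  continuous (x' : weakly X -> R^o).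
Proof.
move=> t; apply: cvg_trans; last first.
  exact: (@initial_continuous X R^o x' t).
apply: cvg_app; have := @cvg_id _ (nbhs (t : weakly X)).
by move/cvg_sup => /(_ x').
Qed.

Lemma weakly_hausdorff : hausdorff_space (weakly X).
Proof.
move=> p q pq; apply/eqP; rewrite -subr_eq0 -normr_eq0.
have [x' [_ <-]] := norming_dual (p - q : X).
rewrite linearB/= subr_eq0; apply/eqP.
apply: (@norm_hausdorff R R^o) => A B Ap Bq.
have [z [Az Bz]] := pq _ _ (dual_weakly_continuous Ap) (dual_weakly_continuous Bq).
by exists (x' z).
Qed.

Lemma weakly_closed_ge (x' : dual X) (a : R) :
  closed ([set v | a <= x' v] : set (weakly X)).
Proof.
apply: (@preimage_closed (weakly X) R^o x' [set r | a <= r]).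
  by move=> v _; exact: dual_weakly_continuous.
exact: closed_ge.
Qed.

(** This double annihilator of the sequence is its closed linear span, by Hahn-Banach; written with
    functionals, it is an intersection of kernels. *)
Lemma weakly_closed_annihilator (c : nat -> X) :
  closed ([set v | forall x' : dual X, (forall n, x' (c n) = 0) -> x' v = 0]
    : set (weakly X)).
Proof.
rewrite (_ : mkset _ = \bigcap_(x' in [set x' : dual X | forall n, x' (c n) = 0])
  (x' : weakly X -> R^o) @^-1` [set 0]); last by [].
apply: closed_bigI => x' _; apply: preimage_closed.
  by move=> v _; exact: dual_weakly_continuous.
exact: closed_eq.
Qed.

End functionals.

(** * Faces of weakly compact sets *)

Section faces.
Context {R : realType} {X : normedModType R}.
Implicit Types (K : set X) (f g : dual X) (s : seq (dual X)).

Definition wkcompact K : Prop := K !=set0 /\ weakly_compact K.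

Lemma wkcompact_closed K : wkcompact K -> closed (K : set (weakly X)).
Proof. by move=> [_ cK]; exact: (compact_closed weakly_hausdorff cK). Qed.

Lemma support_attained K f : wkcompact K ->
  exists p, [/\ K p, f p = support_fun f K :> R &
    forall q, K q -> f q <= support_fun f K].
Proof.
move=> [K0 cK].
have [|p /set_mem Kp pmax] := @compact_EVT_max (weakly X) R f K K0 cK.
  by apply: continuous_subspaceT => v; exact: dual_weakly_continuous.
have pub : ubound (f @` K) (f p).
  by move=> _ [q Kq <-]; apply: pmax; exact: mem_set.
have ple : f p <= support_fun f K.
  by apply: ub_le_sup; [exists (f p : R)|exists p].
have sle : support_fun f K <= f p by apply: ge_sup => //; exists (f p : R), p.
exists p; split=> [//||q Kq]; first by apply/eqP; rewrite eq_le ple.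
by apply: le_trans (pub _ _) ple; exists q.
Qed.

Lemma le_support K f p : wkcompact K -> K p -> f p <= support_fun f K.
Proof. by move=> /support_attained -/(_ f)[q [_ _ h]]; exact: h. Qed.

Lemma support_le K f (a : R) : wkcompact K -> (forall p, K p -> f p <= a) ->
  support_fun f K <= a.
Proof. by move=> /support_attained -/(_ f)[q [Kq <- _]]; exact. Qed.

Lemma support_opp_le K f : wkcompact K ->
  - support_fun (dual_opp f) K <= support_fun f K.
Proof.
move=> wK; have [[p Kp] _] := wK; rewrite lerNl.
apply: le_trans (le_support (dual_opp f) wK Kp).
by rewrite dual_oppE lerN2; exact: le_support.
Qed.

(** On a weakly compact [K] the supremum is a maximum, so this is the set of maximizers of [f]; the
    inequality exhibits it as cut out by a weakly closed half-space. *)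
Definition face f K : set X := K `&` [set p | support_fun f K <= f p].

Lemma wkcompact_face K f : wkcompact K -> wkcompact (face f K).
Proof.
move=> wK; split.
  by have [p [Kp xp _]] := support_attained f wK; exists p; split=> //=; rewrite xp.
apply: (@compact_closedI (weakly X) K _ wK.2).
exact: weakly_closed_ge.
Qed.

Lemma wkcompact_bigcap (F : nat -> set X) : (forall n, wkcompact (F n)) ->
  (forall n, F n.+1 `<=` F n) -> wkcompact (\bigcap_n F n).
Proof.
move=> wF Fdec; split.
  apply: (@nested_compact (weakly X)) => // [n|n|]; first by have [] := wF n.
    exact: wkcompact_closed.
  by have [] := wF 0%N.
apply: (@subclosed_compact (weakly X) _ (F 0%N)).
- by apply: closed_bigI => n _; exact: wkcompact_closed.
- by have [] := wF 0%N.
- by move=> x; apply.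
Qed.

(** The last hypothesis has the form that compactness delivers: a common lower bound [b] yields a
    limit point at which the functional is at least [b]. *)
Lemma nonincreasing_cvg_to (u : nat -> R) (a : R) :
  (forall n, u n.+1 <= u n) -> (forall n, a <= u n) ->
  (forall b, (forall n, b <= u n) -> b <= a) -> u @ \oo --> a.
Proof.
move=> udec au ua; have <- : inf (range u) = a.
  apply/eqP; rewrite eq_le ua/=; last first.
    by move=> n; apply: ge_inf; [exists a => _ [m _ <-]|exists n].
  by apply: lb_le_inf; [exists (u 0%N), 0%N|move=> _ [m _ <-]].
apply: nonincreasing_cvgn; first exact/nonincreasing_seqP.
by exists a => _ [m _ <-].
Qed.

(** If [b] is below every [support_fun f (F n)], the half-space [b <= f] meets each [F n]; by
    compactness it meets their intersection. *)
Lemma support_bigcap_cvg (F : nat -> set X) f : (forall n, wkcompact (F n)) ->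
  (forall n, F n.+1 `<=` F n) ->
  support_fun f (F n) @[n --> \oo] --> support_fun f (\bigcap_n F n).
Proof.
move=> wF Fdec; have wI := wkcompact_bigcap wF Fdec.
apply: nonincreasing_cvg_to => [n|n|b hb].
- by apply: support_le => // p /Fdec Fp; exact: le_support.
- by apply: support_le => // p Fp; apply: le_support => //; exact: Fp.
pose E n := F n `&` [set p | b <= f p].
have [||||p Ep] := @nested_compact (weakly X) E.
- move=> n; have [p [Fp xp _]] := support_attained f (wF n).
  by exists p; split=> //=; rewrite xp.
- move=> n; apply: closedI; [exact: wkcompact_closed|exact: weakly_closed_ge].
- by apply: compact_closedI; [exact: (wF 0%N).2|exact: weakly_closed_ge].
- by move=> n p [/Fdec].
have bp : b <= f p by have [] := Ep 0%N I.
apply: le_trans bp _; apply: le_support => // n _.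
by have [] := Ep n I.
Qed.

(** By homogeneity, for positive [n] this is the difference quotient of the support function at [f]
    in direction [g] with step [1/n]. It is also the maximum over [K] of [g p - n (s(f, K) - f p)],
    which penalizes points off the face. *)
Definition penalty K f g (n : nat) : R :=
  support_fun (dual_comb 1 g n%:R f) K - n%:R * support_fun f K.

(** The penalty term only lowers [g], and it vanishes at a maximizer of [f]. The bound is uniform in
    [n], as dominated convergence requires. *)
Lemma penalty_bound K f g n : wkcompact K ->
  `|penalty K f g n| <= `|support_fun g K| + `|support_fun (dual_opp g) K|.
Proof.
move=> wK; have [p [Kp xp _]] := support_attained f wK.
have ub : penalty K f g n <= support_fun g K.
  rewrite lerBlDr; apply: support_le => // q Kq.
  rewrite dual_combE mul1r lerD ?le_support// ler_wpM2l ?le_support//.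
have lb : - support_fun (dual_opp g) K <= penalty K f g n.
  rewrite lerBrDr; apply: le_trans (le_support _ wK Kp).
  rewrite dual_combE mul1r xp lerD2r lerNl -dual_oppE; exact: le_support.
rewrite ler_norml; apply/andP; split.
  apply: le_trans lb; rewrite lerN2; apply: le_trans (ler_norm _) _.
  by rewrite lerDr.
by apply: le_trans ub _; apply: le_trans (ler_norm _) _; rewrite lerDl.
Qed.

(* The support function of a face is a directional derivative of the support
   function of the set. *)
Lemma penalty_cvg K f g : wkcompact K ->
  penalty K f g n @[n --> \oo] --> support_fun g (face f K).
Proof.
move=> wK; have wF := wkcompact_face f wK.
have dec n p : K p ->
    g p + n.+1%:R * f p - n.+1%:R * support_fun f K <=
    g p + n%:R * f p - n%:R * support_fun f K.
  by move=> /(le_support f wK); rewrite -natr1; lra.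
have val n p : dual_comb 1 g n%:R f p = g p + n%:R * f p :> R.
  by rewrite dual_combE mul1r.
apply: nonincreasing_cvg_to => [n|n|b hb].
- rewrite lerBlDr; apply: support_le => // p Kp; rewrite val -lerBlDr.
  apply: le_trans (dec _ _ Kp) _; rewrite lerD2r -val; exact: le_support.
- apply: support_le => // p [Kp xp]; rewrite lerBrDr.
  apply: le_trans (le_support _ wK Kp); rewrite val lerD2l.
  by rewrite ler_wpM2l.
(* A point [p] common to all [E n] satisfies [n (s(f, K) - f p) <= g p - b] for every [n]: it lies
   in the face since the reals are Archimedean, and [n = 0] gives [b <= g p]. *)
pose E n := K `&` [set p | b + n%:R * support_fun f K <= dual_comb 1 g n%:R f p].
have [||||p Ep] := @nested_compact (weakly X) E.
- move=> n; have [p [Kp xp _]] := support_attained (dual_comb 1 g n%:R f) wK.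
  by exists p; split=> //=; rewrite xp -lerBrDr; exact: hb.
- move=> n; apply: closedI; [exact: wkcompact_closed|exact: weakly_closed_ge].
- by apply: compact_closedI; [exact: wK.2|exact: weakly_closed_ge].
- move=> n p [Kp /=]; rewrite !val -lerBrDr => h; split=> //=.
  by rewrite val -lerBrDr; exact: le_trans h (dec _ _ Kp).
have Kp : K p by have [] := Ep 0%N I.
have bp n : n%:R * (support_fun f K - f p) <= g p - b.
  by have [_ /=] := Ep n I; rewrite val; lra.
have xp : support_fun f K <= f p.
  rewrite -subr_le0 leNgt; apply/negP => d0.
  have := bp (Num.truncn ((g p - b) / (support_fun f K - f p))).+1.
  by rewrite -ler_pdivlMr// leNgt truncnS_gt.
apply: le_trans (le_support g wF (conj Kp xp)).
by have := bp 0%N; rewrite mul0r subr_ge0.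
Qed.

(** With a left fold, appending functionals to [s] refines the face, so growing lists give nested
    faces. *)
Definition iter_face s K : set X := foldl (fun L f => face f L) K s.

Lemma iter_face_cat s1 s2 K : iter_face (s1 ++ s2) K = iter_face s2 (iter_face s1 K).
Proof. exact: foldl_cat. Qed.

Lemma iter_face_sub s K : iter_face s K `<=` K.
Proof.
by elim: s K => [|f s IH] K //; apply: subset_trans (IH _) _ => p [].
Qed.

Lemma wkcompact_iter_face s K : wkcompact K -> wkcompact (iter_face s K).
Proof.
by elim: s K => [|f s IH] K // wK; apply: IH; exact: wkcompact_face.
Qed.

Lemma iter_face_prefix s1 s2 K : iter_face (s1 ++ s2) K `<=` iter_face s1 K.
Proof. by rewrite iter_face_cat; exact: iter_face_sub. Qed.

End faces.

(** * Iterated faces of small diameter *)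

Section small_faces.
Context {R : realType} {X : normedModType R}.
Implicit Types (K : set X) (s : seq (dual X)).

(** Missing coefficients are 0, so every [n] at least [size r] gives the same vector. Lists of
    rationals can be enumerated by [pickle]. *)
Definition rat_comb (c : nat -> X) n (r : seq rat) : X :=
  \sum_(i < n) ratr (nth 0 r i) *: c i.

Lemma rat_comb_dense (c : nat -> X) x e : 0 < e -> seq_span c x ->
  exists r : seq rat, forall n, (size r <= n)%N -> `|x - rat_comb c n r| < e.
Proof.
(* With this [d], each of the [m] terms errs by at most [e / m.+1], which keeps the total strictly
   below [e]; the summand 1 avoids a division by zero. *)
move=> e0 [m [a ->]]; pose d i := e / (m.+1%:R * (1 + `|c i|)).
have c0 i : 0 < 1 + `|c i| by rewrite ltr_pwDl.
have d0 i : 0 < d i by rewrite divr_gt0// mulr_gt0.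
have /choice[q qa] : forall i, exists q : rat, `|a i - ratr q| <= d i.
  move=> i; have [|q] := @rat_in_itvoo R (a i - d i) (a i + d i).
    by have := d0 i; lra.
  by rewrite in_itv/= => /andP[h1 h2]; exists q; rewrite ler_norml; lra.
exists (mkseq q m) => n; rewrite size_mkseq => mn.
have -> : rat_comb c n (mkseq q m) = \sum_(i < m) ratr (q i) *: c i.
  rewrite /rat_comb (big_ord_widen n (fun i => ratr (q i) *: c i) mn) [RHS]big_mkcond.
  apply: eq_bigr => i _; case: ifPn => im; first by rewrite nth_mkseq.
  by rewrite nth_default ?raddf0 ?scale0r// size_mkseq leqNgt.
rewrite -sumrB; apply: le_lt_trans (ler_norm_sum _ _ _) _.
apply: (@le_lt_trans _ _ (\sum_(i < m) e / m.+1%:R)).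
  apply: ler_sum => i _; rewrite -scalerBl normrZ.
  apply: le_trans (ler_wpM2r _ (qa i)) _ => //.
  rewrite /d invfM mulrA -[leLHS]mulrA ler_piMr//; first by rewrite divr_ge0 ?(ltW e0).
  by rewrite ler_pdivrMl// mulr1 lerDr.
rewrite sumr_const card_ord -[ltLHS]mulr_natr -mulrA gtr_pMr//.
by rewrite ltr_pdivrMl// mulr1 ltr_nat.
Qed.

(** Some [z] of the iterated face is farther than [e / 2] from [q]. If [f] norms [z - q], then on
    the face exposed by [f] one has [|p - q| >= f (p - q) >= f (z - q) = |z - q|]. *)
Lemma iter_face_avoid K s q (e : R) : wkcompact K ->
  (forall s, exists x y, [/\ iter_face s K x, iter_face s K y & e < `|x - y|]) ->
  exists s', forall p, iter_face (s ++ s') K p -> e / 2 < `|p - q|.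
Proof.
move=> wK Klarge; have [z sz ez] : exists2 z, iter_face s K z & e / 2 < `|z - q|.
  have [x [y [sx sy exy]]] := Klarge s.
  have [?|xq] := ltP (e / 2) `|x - q|; first by exists x.
  exists y => //; have := ler_distD q x y; rewrite (distrC q y); lra.
have [f [f1 fz]] := norming_dual (z - q).
exists [:: f] => p; rewrite iter_face_cat => -[sp /= fp].
apply: lt_le_trans ez _; rewrite -fz; apply: le_trans (f1 _).
rewrite !linearB/= lerD2r; apply: le_trans fp.
by apply: le_support => //; exact: wkcompact_iter_face.
Qed.

Lemma iter_face_avoid_seq K s (qs : seq X) (e : R) : wkcompact K ->
  (forall s, exists x y, [/\ iter_face s K x, iter_face s K y & e < `|x - y|]) ->
  exists s', forall p, iter_face (s ++ s') K p ->
    forall q, q \in qs -> e / 2 < `|p - q|.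
Proof.
move=> wK Klarge; elim: qs => [|q qs [s1 h1]]; first by exists [::].
have [s2 h2] := iter_face_avoid (s ++ s1) q wK Klarge.
exists (s1 ++ s2) => p; rewrite catA => hp q'; rewrite inE => /predU1P[->|].
  exact: h2.
by apply: h1; exact: iter_face_prefix hp.
Qed.

(* Otherwise one builds decreasing iterated faces [L n] and points [c n] of
   [L n] such that [L n.+1] keeps away from the first rational combinations of
   [c 0, ..., c n]. By weak compactness the closed linear span of the [c n]
   meets the intersection of the [L n], which avoids all the rational
   combinations. *)
Lemma exists_small_iter_face K (e : R) : wkcompact K -> 0 < e ->
  exists s, forall x y, iter_face s K x -> iter_face s K y -> `|x - y| <= e.
Proof.
move=> wK e0; apply: contrapT => nsmall.
have Klarge s : exists x y, [/\ iter_face s K x, iter_face s K y & e < `|x - y|].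
  apply: contrapT => h; apply: nsmall; exists s => x y sx sy.
  by rewrite leNgt; apply/negP => exy; apply: h; exists x, y.
have /choice[pt ptP] : forall s, exists p, iter_face s K p.
  by move=> s; have [[p sp] _] := wkcompact_iter_face s wK; exists p.
have /choice[av avP] : forall sq : seq (dual X) * seq X, exists s',
    forall p, iter_face (sq.1 ++ s') K p -> forall q, q \in sq.2 -> e / 2 < `|p - q|.
  by move=> [s qs]; exact: iter_face_avoid_seq.
(* The combinations whose coefficient lists have code below [n]; a number that codes no list stands
   for the zero combination. *)
pose combs n (cs : seq X) := [seq rat_comb (nth 0 cs) n (odflt [::] (unpickle m))
  | m <- iota 0 n].
pose next n (st : seq (dual X) * seq X) :=
  let cs := rcons st.2 (pt st.1) in (st.1 ++ av (st.1, combs n.+1 cs), cs).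
pose st := fix st n := if n is m.+1 then next m (st m) else ([::], [::]).
pose c n := pt (st n).1.
pose L n := iter_face (st n).1 K.
have stc n : (st n).2 = mkseq c n.
  by elim: n => [//|n IH]; rewrite /= IH /mkseq -addn1 iotaD map_cat cats1.
have wL n : wkcompact (L n) by exact: wkcompact_iter_face.
have Ldec n : L n.+1 `<=` L n by exact: iter_face_prefix.
have Lav n m p : (m <= n)%N -> L n.+1 p ->
    e / 2 < `|p - rat_comb c n.+1 (odflt [::] (unpickle m))|.
  move=> mn Lp; apply: (avP _ _ Lp); apply/mapP; exists m.
    by rewrite mem_iota.
  rewrite stc; apply: eq_bigr => i _; congr (_ *: _).
  rewrite (_ : rcons _ _ = mkseq c n.+1) ?nth_mkseq//.
  by rewrite /mkseq -addn1 iotaD map_cat cats1.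
pose Z : set (weakly X) :=
  [set v | forall f : dual X, (forall n, f (c n) = 0) -> f v = 0].
have Zcl : closed Z by exact: weakly_closed_annihilator.
have [||||p Lp] := @nested_compact (weakly X) (fun n => L n `&` Z).
- by move=> n; exists (c n); split; [exact: ptP|move=> f; exact].
- by move=> n; apply: closedI => //; exact: wkcompact_closed.
- by apply: compact_closedI => //; exact: (wL 0%N).2.
- by move=> n p [/Ldec].
have e4 : 0 < e / 4 by rewrite divr_gt0.
have [x cx px] := closure_seq_span e4 (Lp 0%N I).2.
have [r rx] := rat_comb_dense e4 cx.
(* Such an [n] exceeds neither requirement's reach: by the code of [r], [L n.+1] stays [e / 2] away
   from its combination, and by the length of [r], that combination is within [e / 4] of [x], itself
   within [e / 4] of [p]. *)
pose n := maxn (pickle r) (size r).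
have := Lav n (pickle r) p (leq_maxl _ _) (Lp n.+1 I).1.
rewrite pickleK/=.
have := rx n.+1 (leqW (leq_maxr _ _)).
have := ler_distD x p (rat_comb c n.+1 r); lra.
Qed.

(** Small faces are found successively inside the face already reached, the one of [S n.+1] having
    diameter at most [1/(n+1)]. *)
Lemma exists_iter_face_point K : wkcompact K ->
  exists S : nat -> seq (dual X), (forall n, exists s, S n.+1 = S n ++ s) /\
    forall x y, (forall n, iter_face (S n) K x) -> (forall n, iter_face (S n) K y) ->
      x = y.
Proof.
move=> wK.
have /choice[nx nxP] : forall sn : seq (dual X) * nat, exists s',
    forall x y, iter_face (sn.1 ++ s') K x -> iter_face (sn.1 ++ s') K y ->
      `|x - y| <= sn.2.+1%:R^-1.
  move=> [s n]; have := @exists_small_iter_face (iter_face s K) n.+1%:R^-1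
    (wkcompact_iter_face s wK).
  rewrite invr_gt0 ltr0n => /(_ isT)[s' hs']; exists s' => x y.
  by rewrite iter_face_cat; exact: hs'.
pose S := fix S n := if n is m.+1 then S m ++ nx (S m, m) else [::].
exists S; split=> [n|x y Sx Sy]; first by exists (nx (S n, n)).
apply/eqP; rewrite -subr_eq0 -normr_le0 leNgt; apply/negP => d0.
have := nxP _ _ _ (Sx (Num.truncn `|x - y|^-1).+1) (Sy (Num.truncn `|x - y|^-1).+1).
rewrite /= leNgt -[ltRHS]invrK ltf_pV2 ?posrE ?invr_gt0//.
by rewrite truncnS_gt.
Qed.

End small_faces.

(** * Integration of faces *)

Section real_integrals.
Context {R : realType} {d : measure_display} {T : measurableType d}.
Variable mu : {measure set T -> \bar R}.
Implicit Types (u v h : T -> R) (A : set T).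

Lemma integrable_comb a u b v :
  mu.-integrable setT (fun t => (u t)%:E) ->
  mu.-integrable setT (fun t => (v t)%:E) ->
  mu.-integrable setT (fun t => (a * u t + b * v t)%:E).
Proof.
by move=> iu iv; exact: integrableD (integrableZl _ a iu) (integrableZl _ b iv).
Qed.

Lemma integral_comb A a u b v (p q : R) : measurable A ->
  mu.-integrable setT (fun t => (u t)%:E) ->
  mu.-integrable setT (fun t => (v t)%:E) ->
  p%:E = (\int[mu]_(t in A) (u t)%:E)%E ->
  q%:E = (\int[mu]_(t in A) (v t)%:E)%E ->
  (a * p + b * q)%:E = (\int[mu]_(t in A) (a * u t + b * v t)%:E)%E.
Proof.
move=> mA iu iv pu qv.
have {}iu := integrableS measurableT mA (@subsetT _ _) iu.
have {}iv := integrableS measurableT mA (@subsetT _ _) iv.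
rewrite EFinD !EFinM pu qv -!integralZl// -integralD//; exact: integrableZl.
Qed.

(** Dominated convergence, in the form that carries the integral identities of support functions to
    the limit on each measurable set. *)
Lemma integral_dominated_limit (u : nat -> T -> R) v h :
  (forall n, mu.-integrable setT (fun t => (u n t)%:E)) ->
  mu.-integrable setT (fun t => (h t)%:E) ->
  (forall n t, `|u n t| <= h t) ->
  (forall t, u n t @[n --> \oo] --> v t) ->
  mu.-integrable setT (fun t => (v t)%:E) /\
  forall A (p : nat -> R) (q : R), measurable A ->
    (forall n, (p n)%:E = (\int[mu]_(t in A) (u n t)%:E)%E) ->
    p @ \oo --> q -> q%:E = (\int[mu]_(t in A) (v t)%:E)%E.
Proof.
move=> iu ih uh uv.
have lim A : measurable A ->
    mu.-integrable A (fun t => (v t)%:E) /\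
    (\int[mu]_(t in A) (u n t)%:E)%E @[n --> \oo] -->
      (\int[mu]_(t in A) (v t)%:E)%E.
  move=> mA.
  have mu_ n : measurable_fun A (u n).
    apply/measurable_EFinP; apply: measurable_int.
    exact: integrableS measurableT mA (@subsetT _ _) (iu n).
  have [|||||iv _ cv] := @dominated_convergence _ _ _ mu A mA
      (fun n t => (u n t)%:E) (fun t => (v t)%:E) (fun t => (h t)%:E).
  - by move=> n; exact/measurable_EFinP.
  - by apply/measurable_EFinP; exact: (measurable_fun_cvg mu_ (fun t _ => uv t)).
  - by apply/aeW => t _; apply: cvg_EFin; [exact: nearW|exact: uv].
  - exact: integrableS measurableT mA (@subsetT _ _) ih.
  - by apply/aeW => t n _; rewrite lee_fin.
  - by [].
split=> [|A p q mA pu pq]; first by have [] := lim _ measurableT.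
have [_ cv] := lim _ mA.
have cp : (p n)%:E @[n --> \oo] --> q%:E.
  by apply: cvg_EFin; [exact: nearW|exact: pq].
have pE : (fun n => (p n)%:E) = (fun n => (\int[mu]_(t in A) (u n t)%:E)%E).
  by apply/funext => n.
rewrite pE in cp.
by apply: cvg_unique cp cv; exact: ereal_hausdorff.
Qed.

End real_integrals.

(** * Pettis integrals of faces and Pettis integrable selections *)

Section set_integrals.
Context {R : realType} {X : normedModType R}.
Context {d : measure_display} {T : measurableType d}.
Variable mu : {measure set T -> \bar R}.
Implicit Types (F : T -> set X) (W : set T -> set X).

(** Naming the integral as a function [W] of the set allows faces and intersections to be taken in
    [F] and [W] simultaneously. *)
Definition set_integral (F : T -> set X) (W : set T -> set X) : Prop :=
  [/\ forall t, wkcompact (F t), scalarly_integrable mu F &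
    forall A, measurable A -> wkcompact (W A) /\ forall f : dual X,
      (support_fun f (W A))%:E = (\int[mu]_(t in A) (support_fun f (F t))%:E)%E].

Lemma integrable_support_bound F (f : dual X) : scalarly_integrable mu F ->
  mu.-integrable setT
    (fun t => (`|support_fun f (F t)| + `|support_fun (dual_opp f) (F t)|)%:E).
Proof.
by move=> iF; exact: integrableD (integrable_norm (iF f)) (integrable_norm (iF _)).
Qed.

(** A penalty is a linear combination of two support functions, so the penalties of [F t] integrate
    to that of [W A]; both sides then converge to the support functions of the faces. *)
Lemma set_integral_face F W (f : dual X) :
  set_integral F W -> set_integral (fun t => face f (F t)) (fun A => face f (W A)).
Proof.
move=> [wF iF FW].
have pen t g n : penalty (F t) f g n = 1 * support_fun (dual_comb 1 g n%:R f) (F t)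
    + (- n%:R) * support_fun f (F t).
  by rewrite mul1r mulNr.
have key g := @integral_dominated_limit _ _ _ mu
  (fun n t => penalty (F t) f g n) (fun t => support_fun g (face f (F t)))
  (fun t => `|support_fun g (F t)| + `|support_fun (dual_opp g) (F t)|).
have hyp g (ig : _) := key g ig (integrable_support_bound g iF)
  (fun n t => penalty_bound f g n (wF t)) (fun t => penalty_cvg (wF t)).
have pint g n : mu.-integrable setT (fun t => (penalty (F t) f g n)%:E).
  under eq_fun do rewrite pen.
  by apply: integrable_comb; exact: iF.
split=> [t|g|A mA]; first exact: wkcompact_face.
  by have [] := hyp g (pint g).
have [wW sW] := FW A mA; split=> [|g]; first exact: wkcompact_face.
have [_] := hyp g (pint g); apply; [exact: mA| |exact: penalty_cvg].
move=> n; under eq_integral do rewrite pen.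
rewrite -[penalty _ _ _ _]/(_ - _) -[X in (X - _)%:E]mul1r -mulNr.
by apply: integral_comb => //; exact: iF.
Qed.

Lemma set_integral_iter_face F W s : set_integral F W ->
  set_integral (fun t => iter_face s (F t)) (fun A => iter_face s (W A)).
Proof.
elim: s F W => [//|f s IH] F W FW.
exact: IH (set_integral_face f FW).
Qed.

(** Support functions converge along both intersections, and those of [F n t] lie between
    [- s(- f, F 0 t)] and [s(f, F 0 t)], which gives an integrable bound. *)
Lemma set_integral_bigcap (F : nat -> T -> set X) (W : nat -> set T -> set X) :
  (forall n, set_integral (F n) (W n)) ->
  (forall n t, F n.+1 t `<=` F n t) -> (forall n A, W n.+1 A `<=` W n A) ->
  set_integral (fun t => \bigcap_n F n t) (fun A => \bigcap_n W n A).
Proof.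
move=> FW Fdec Wdec; have wF n t : wkcompact (F n t) by have [] := FW n.
have iF n : scalarly_integrable mu (F n) by have [] := FW n.
have F0 n t : F n t `<=` F 0%N t.
  by elim: n => [//|n IH]; exact: subset_trans (Fdec n t) IH.
have bound (f : dual X) n t : `|support_fun f (F n t)| <=
    `|support_fun f (F 0%N t)| + `|support_fun (dual_opp f) (F 0%N t)|.
  have mono g : support_fun g (F n t) <= support_fun g (F 0%N t).
    by apply: support_le => // p /F0; exact: le_support.
  have h1 := mono f; have h2 := mono (dual_opp f).
  have h3 := support_opp_le f (wF n t).
  have h4 := ler_norm (support_fun f (F 0%N t)).
  have h5 := ler_norm (support_fun (dual_opp f) (F 0%N t)).
  have h6 := normr_ge0 (support_fun f (F 0%N t)).
  have h7 := normr_ge0 (support_fun (dual_opp f) (F 0%N t)).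
  by rewrite ler_norml; apply/andP; split; lra.
have hyp (f : dual X) := integral_dominated_limit (fun n => iF n f)
  (integrable_support_bound f (iF 0%N)) (bound f)
  (fun t => support_bigcap_cvg (wF^~ t) (Fdec^~ t)).
split=> [t|f|A mA]; first exact: wkcompact_bigcap.
  by have [] := hyp f.
have wW n : wkcompact (W n A) by have [_ _ /(_ A mA)[]] := FW n.
split=> [|f]; first exact: wkcompact_bigcap.
have [_] := hyp f; apply; [exact: mA| |exact: support_bigcap_cvg].
by move=> n; have [_ _ /(_ A mA)[_]] := FW n.
Qed.

(* The nonnegative width [s(f, F) + s(- f, F)] has integral zero, so the values
   of [f] on [F] are almost everywhere determined. *)
Lemma pettis_integrable_selection F W (s : T -> X) : measure_is_complete mu ->
  set_integral F W -> (forall x y, W setT x -> W setT y -> x = y) ->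
  (forall t, F t (s t)) -> pettis_integrable_fun mu s.
Proof.
move=> cmu [wF iF FW] W1 Fs.
pose width f t := 1 * support_fun f (F t) + 1 * support_fun (dual_opp f) (F t).
have iwidth f : mu.-integrable setT (fun t => (width f t)%:E).
  by apply: integrable_comb; exact: iF.
have width_ge0 f t : 0 <= width f t.
  by rewrite /width !mul1r; have := support_opp_le f (wF t); lra.
have Wwidth A f : measurable A -> (1 * support_fun f (W A) +
    1 * support_fun (dual_opp f) (W A))%:E = (\int[mu]_(t in A) (width f t)%:E)%E.
  move=> mA; have [_ WA] := FW A mA.
  by apply: integral_comb => //; exact: iF.
have width_ae0 f : ae_eq mu setT (fun t => (width f t)%:E) (cst 0%E).
  apply/ae_eq_integral_abs => //; first exact: measurable_int (iwidth f).
  under eq_integral do rewrite gee0_abs ?lee_fin//.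
  (* The integral of the width is the width of [W setT], a single point. *)
  rewrite -Wwidth// !mul1r; have [wW _] := FW setT measurableT.
  have [p [Wp <- _]] := support_attained f wW.
  have [q [Wq <- _]] := support_attained (dual_opp f) wW.
  by rewrite (W1 _ _ Wq Wp) dual_oppE subrr.
have le_sel (f : dual X) t : f (s t) <= support_fun f (F t) by exact: le_support.
have sel_ae (f : dual X) : ae_eq mu setT
    (fun t => (support_fun f (F t))%:E) (fun t => (f (s t) : R)%:E).
  apply: filterS (width_ae0 f) => t h /h{h}[w0]; congr EFin.
  apply/eqP; rewrite eq_le le_sel andbT.
  have := le_sel (dual_opp f) t; rewrite dual_oppE.
  by move: w0; rewrite /width !mul1r; lra.
have mF f : measurable_fun setT (fun t => (support_fun f (F t))%:E).
  exact: measurable_int (iF f).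
(* Completeness of [mu] enters here: [f (s t)] is known only to agree almost everywhere with a
   measurable function. *)
have msel (f : dual X) : measurable_fun setT (fun t => (f (s t) : R)%:E).
  exact: (ae_measurable_fun cmu (sel_ae f) (mF f)).
split=> [f|A mA].
  apply: le_integrable (integrable_support_bound f iF) => //.
  move=> t _; rewrite lee_fin [leRHS]ger0_norm ?addr_ge0//.
  have h1 := le_sel f t; have h2 := le_sel (dual_opp f) t; rewrite dual_oppE in h2.
  have h4 := ler_norm (support_fun f (F t)).
  have h5 := ler_norm (support_fun (dual_opp f) (F t)).
  have h6 := normr_ge0 (support_fun f (F t)).
  have h7 := normr_ge0 (support_fun (dual_opp f) (F t)).
  by rewrite ler_norml; apply/andP; split; lra.
(* Any point of [W A] can serve as the integral over [A]: the width of [W A] in each direction is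
   zero, so [f] is constant on it. *)
have [wW WA] := FW A mA; have [[a Wa] _] := wW; exists a => f.
have <- : support_fun f (W A) = f a.
  apply/eqP; rewrite eq_le le_support// andbT.
  have w0 : (\int[mu]_(t in A) (width f t)%:E = 0)%E.
    have h : ae_eq mu A (fun t => (width f t)%:E) (cst 0%E).
      exact: ae_eq_subset (width_ae0 f).
    rewrite (ae_eq_integral (cst 0%E) _ mA _ _ h) ?integral0//.
    by apply: measurable_funTS; exact: measurable_int (iwidth f).
  have := Wwidth A f mA; rewrite w0 => -[].
  by have := le_support (dual_opp f) wW Wa; rewrite dual_oppE !mul1r; lra.
rewrite WA; apply: ae_eq_integral => //.
- exact: measurable_funTS.
- exact: measurable_funTS.
- exact: ae_eq_subset (sel_ae f).
Qed.

Lemma exists_pettis_selection F : measure_is_complete mu ->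
  (forall t, wkcompact (F t)) -> pettis_integrable mu F ->
  pettis_selections mu F !=set0.
Proof.
move=> cmu wF [iF FW].
have /choice[W WP] : forall A, exists V : set X, measurable A ->
    wkcompact V /\ forall f : dual X, (support_fun f V)%:E =
      (\int[mu]_(t in A) (support_fun f (F t))%:E)%E.
  move=> A; have [mA|nmA] := pselect (measurable A); last by exists set0.
  by have [V [[V0 _ cV] sV]] := FW A mA; exists V.
have FWint : set_integral F W by [].
(* The functionals are chosen to shrink [W setT], then applied to every [F t]. *)
have [S [Sdec S1]] := exists_iter_face_point (WP _ measurableT).1.
have dec n K : iter_face (S n.+1) K `<=` iter_face (S n) K.
  by have [s ->] := Sdec n; exact: iter_face_prefix.
have lim := set_integral_bigcap (fun n => set_integral_iter_face (S n) FWint)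
  (fun n t => dec n (F t)) (fun n A => dec n (W A)).
have /choice[s sP] : forall t, exists x, (\bigcap_n iter_face (S n) (F t)) x.
  by move=> t; have [/(_ t)[? _]] := lim.
exists s; split; last by move=> t; exact: iter_face_sub (sP t 0%N I).
apply: (pettis_integrable_selection cmu lim) => // x y Wx Wy.
by apply: S1 => n; [exact: Wx|exact: Wy].
Qed.

End set_integrals.

(** * Translations *)

Section translations.
Context {R : realType} {X : normedModType R}.
Implicit Types (K : set X) (a : X).

Lemma cwk_wkcompact K : cwk K -> wkcompact K.
Proof. by case. Qed.

(** This is [K - a], written as a preimage so that it commutes with taking levels by definition. *)
Definition translate a K : set X := [set x | K (x + a)].

(** Weak continuity is tested on each functional, where [f (y + a) = f y + f a]. *)
Lemma weakly_continuous_addr a : continuous ((fun x => x + a) : weakly X -> weakly X).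
Proof.
move=> x.
have FF : Filter (((fun y => y + a) : weakly X -> weakly X) @ nbhs (x : weakly X)).
  by apply: fmap_filter.
apply/cvg_sup => f.
have fa : continuous (fun y : weakly X => (f y : R^o) + f a).
  by move=> y; apply: (cvgD (dual_weakly_continuous (x := y)) (cvg_cst _)).
apply: (@continuous_comp_initial _ (weakly X) _ f (fun y => y + a)).
rewrite (_ : _ \o _ = fun y : weakly X => (f y : R^o) + f a)//.
by apply/funext => y /=; rewrite linearD.
Qed.

Lemma cwk_translate a K : cwk K -> cwk (translate a K).
Proof.
move=> [[p Kp] cK wK]; split.
- by exists (p - a); rewrite /translate/= subrK.
- move=> x y l; rewrite !inE /translate/= => Kx Ky.
  rewrite -[X in _ + X](convmm l (a : convex_lmodType X)) addrACA -!scalerDr.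
  by apply/set_mem/cK; exact: mem_set.
have -> : translate a K = (fun x : weakly X => x + - a : weakly X) @` K.
  apply/seteqP; split=> [x Kx|_ [x Kx <-]]; last by rewrite /translate/= subrK.
  by exists (x + a) => //; rewrite addrK.
apply: (@continuous_compact (weakly X) (weakly X)) => //.
by apply: continuous_subspaceT; exact: weakly_continuous_addr.
Qed.

Lemma support_translate (f : dual X) a K : cwk K ->
  support_fun f (translate a K) = support_fun f K - f a.
Proof.
move=> cK; have wK := cwk_wkcompact cK.
have wT := cwk_wkcompact (cwk_translate a cK).
apply/eqP; rewrite eq_le; apply/andP; split.
  apply: support_le => // x Kx; rewrite lerBrDr -linearD; exact: le_support.
rewrite lerBlDr; apply: support_le => // x Kx.
rewrite -lerBlDr -linearB; apply: le_support => //.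
by rewrite /translate/= subrK.
Qed.

Definition fuzzy_translate a (u : fuzzy_number X) : fuzzy_number X :=
  FuzzyNumber (fun x => membership_itv u (x + a))
    (fun r r01 => cwk_translate a (level_cwk u r01)).

Lemma level_fuzzy_translate a u (r : R) :
  level (fuzzy_translate a u) r = translate a (level u r).
Proof. by []. Qed.

(** Adding a one-point fuzzy number is a translation, hence can be undone by the opposite one. *)
Lemma is_fuzzy_sum_pointP (w u : fuzzy_number X) a :
  is_fuzzy_sum w u (fuzzy_point a) <->
  forall r : R, 0 < r <= 1 -> level w r = level (fuzzy_translate (- a) u) r.
Proof.
suff sumE (r : R) : 0 < r <= 1 ->
    [set y + z | y in level u r & z in level (fuzzy_point a) r] =
    level (fuzzy_translate (- a) u) r.
  by split=> h r r01; [rewrite -sumE// h|rewrite h// sumE].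
move=> r01; rewrite level_fuzzy_translate level_indic1//.
apply/seteqP; split=> [_ [y uy [_ -> <-]]|x ux].
  by rewrite /translate/= addrK.
by exists (x - a) => //; exists a => //; rewrite subrK.
Qed.

End translations.

(** * Pettis integrability of translated fuzzy mappings *)

Section fuzzy_pettis.
Context {R : realType} {X : normedModType R}.
Context {d : measure_display} {T : measurableType d}.
Variable mu : {measure set T -> \bar R}.

Lemma eq_fuzzy_pettis_integrable (G H : T -> fuzzy_number X) :
  (forall t (r : R), 0 < r <= 1 -> level (G t) r = level (H t) r) ->
  fuzzy_pettis_integrable mu G -> fuzzy_pettis_integrable mu H.
Proof.
move=> GH [iG MG].
have E (r : R) : 0 < r <= 1 -> fuzzy_level G r = fuzzy_level H r.
  by move=> r01; apply/funext => t; exact: GH.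
split=> [r r01|A mA]; first by rewrite -E//; exact: iG.
by have [M sM] := MG A mA; exists M => r f r01; rewrite -E//; exact: sM.
Qed.

Lemma pettis_integrable_funN (f : T -> X) :
  pettis_integrable_fun mu f -> pettis_integrable_fun mu (fun t => - f t).
Proof.
move=> [intf F].
have E (x' : dual X) t : (x' (- f t) : R) = -1 * x' (f t) + 0 * x' (f t).
  by rewrite linearN mulN1r mul0r addr0.
split=> [x'|A mA].
  by under eq_fun do rewrite E; exact: integrable_comb.
have [p pE] := F A mA; exists (- p) => x'.
under eq_integral do rewrite E.
rewrite (_ : x' (- p) = -1 * x' p + 0 * x' p); first exact: integral_comb.
by rewrite linearN mulN1r mul0r addr0.
Qed.

(** The integral over [A] is translated by the integral [p] of [f]. The same [p] serves all [r], so
    the translated levels belong to one fuzzy number. *)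
Lemma fuzzy_pettis_integrable_translate (G : T -> fuzzy_number X) (f : T -> X) :
  fuzzy_pettis_integrable mu G -> pettis_integrable_fun mu f ->
  fuzzy_pettis_integrable mu (fun t => fuzzy_translate (f t) (G t)).
Proof.
move=> [iG MG] [intf If].
have E (x' : dual X) (r : R) t : 0 < r <= 1 ->
    support_fun x' (fuzzy_level (fun t => fuzzy_translate (f t) (G t)) r t) =
    1 * support_fun x' (fuzzy_level G r t) + (-1) * x' (f t).
  by move=> r01; rewrite mul1r mulN1r -support_translate//; exact: level_cwk.
have int_translate (x' : dual X) (r : R) A p (K : set X) : 0 < r <= 1 ->
    measurable A -> cwk K ->
    (x' p : R)%:E = (\int[mu]_(t in A) (x' (f t) : R)%:E)%E ->
    (support_fun x' K)%:E =
      (\int[mu]_(t in A) (support_fun x' (fuzzy_level G r t))%:E)%E ->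
    (support_fun x' (translate p K))%:E = (\int[mu]_(t in A)
      (support_fun x' (fuzzy_level (fun t => fuzzy_translate (f t) (G t)) r t))%:E)%E.
  move=> r01 mA cK pE KE; under eq_integral do rewrite E//.
  rewrite support_translate// -[X in (X - _)%:E]mul1r -[X in (_ + X)%:E]mulN1r.
  by apply: integral_comb => //; have [h _] := iG r r01; exact: h.
split=> [r r01|A mA].
  have [sG WG] := iG r r01; split=> [x'|A mA].
    by under eq_fun do rewrite E//; apply: integrable_comb; [exact: sG|exact: intf].
  have [p pE] := If A mA; have [W [cW WE]] := WG A mA.
  exists (translate p W); split=> [|x']; first exact: cwk_translate.
  exact: int_translate.
have [p pE] := If A mA; have [M ME] := MG A mA.
exists (fuzzy_translate p M) => r x' r01.
rewrite level_fuzzy_translate; apply: int_translate => //; last exact: ME.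
exact: level_cwk.
Qed.

End fuzzy_pettis.

(* [measure_is_complete mu]: the sigma-algebra of T consists of all the
   mu-measurable sets. *)
Theorem theorem3p4 (R : realType) (d : measure_display) (T : measurableType d)
  (mu : {measure set T -> \bar R}) (mu_complete : measure_is_complete mu)
  (X : completeNormedModType R) (G : T -> fuzzy_number X)
  (G_scal : fuzzy_scalarly_integrable mu G) :
  fuzzy_pettis_integrable mu G <->
  (pettis_selections mu (fuzzy_level G 1) !=set0 /\
   forall f : T -> X, pettis_selections mu (fuzzy_level G 1) f ->
     exists H : T -> fuzzy_number X,
       [/\ fuzzy_pettis_integrable mu H,
           forall t, is_fuzzy_sum (G t) (H t) (fuzzy_point (f t)) &
           forall (r : R) (t : T), 0 < r <= 1 -> fuzzy_level H r t 0]).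
Proof.
have one01 : 0 < (1 : R) <= 1 by rewrite ltr01 lexx.
split=> [GP|[[f0 Sf0] GH]]; last first.
  (* Translating [H t] by [- f0 t] recovers [G t] at every level. *)
  have [H [HP sumH _]] := GH f0 Sf0.
  have HfP := fuzzy_pettis_integrable_translate HP (pettis_integrable_funN Sf0.1).
  apply: eq_fuzzy_pettis_integrable HfP => t r r01.
  by have /is_fuzzy_sum_pointP -> := sumH t.
split=> [|f [fP fG]].
  apply: exists_pettis_selection => //; last exact: GP.1.
  by move=> t; apply: cwk_wkcompact; exact: level_cwk.
exists (fun t => fuzzy_translate (f t) (G t)); split.
- exact: fuzzy_pettis_integrable_translate.
- move=> t; apply/is_fuzzy_sum_pointP => r r01; rewrite !level_fuzzy_translate.
  by apply/seteqP; split=> x; rewrite /translate/= subrK.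
(* The origin lies in the translated level because [f t] lies in the level 1 of [G t], which is
   contained in every level [r <= 1]. *)
move=> r t /andP[_ r1]; rewrite /fuzzy_level level_fuzzy_translate /translate/= add0r.
exact: le_trans r1 (fG t).
Qed.
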